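(* Let $\alpha\ge1$, $n=\sum_{i=1}^\alpha n_i$, $\mathbb{R}^n=\prod_{i=1}^\alpha\mathbb{R}^{n_i}$, let $a>0$, and let $f:\mathbb{R}^n\to\mathbb{R}\cup\{+\infty\}$ be a lower semicontinuous $a$-strongly convex function which is proper. Then: 1. $f$ has a unique minimizer $x^*$. 2. Let $c>0$ satisfy $c\ge\frac{\sqrt\alpha-1}{a}$, and let $F=(I+c\,\partial f)^{-1}$ (a single-valued mapping). Then any asynchronous parallel algorithm with bounded delays associated with $F$ converges in $\mathbb{R}^n$ to the minimizer $x^*$ of $f$.
   Context: Vectors of $\mathbb{R}^n=\prod_{i=1}^{\alpha}\mathbb{R}^{n_i}$ are written $x=(x_1,\dots,x_\alpha)$, $x_i\in\mathbb{R}^{n_i}$. Each $\mathbb{R}^{n_i}$ has an inner product $\langle\cdot,\cdot\rangle_i$, and $\mathbb{R}^n$ has the inner product $\langle x,y\rangle=\sum_{i=1}^\alpha\langle x_i,y_i\rangle_i$ with associated norm $\|x\|=\langle x,x\rangle^{1/2}$. $f$ is proper if it is not identically $+\infty$. $f$ is $a$-strongly convex ($a>0$) if $f(tx+(1-t)x')\le tf(x)+(1-t)f(x')-\frac12 a t(1-t)\|x-x'\|^2$ for all $x,x'\in\mathbb{R}^n$ and $t\in(0,1)$. The subdifferential of $f$ is the (generally multivalued) mapping $\partial f(x)=\{y\in\mathbb{R}^n: f(x')\ge f(x)+\langle y,x'-x\rangle\ \forall x'\in\mathbb{R}^n\}$. Asynchronous parallel algorithm associated with $F=(F_1,\dots,F_\alpha):\mathbb{R}^n\to\mathbb{R}^n$: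 given $x^0\in\mathbb{R}^n$, a sequence $\{J(p)\}_{p\in\mathbb{N}}$ of nonempty subsets of $\{1,\dots,\alpha\}$ and a sequence $\{(s_1(p),\dots,s_\alpha(p))\}_{p\in\mathbb{N}}$ in $\mathbb{N}^\alpha$, it generates for $p=0,1,\dots$ and $i=1,\dots,\alpha$: $x_i^{p+1}=x_i^p$ if $i\notin J(p)$, and $x_i^{p+1}=F_i(x_1^{s_1(p)},\dots,x_\alpha^{s_\alpha(p)})$ if $i\in J(p)$. It has bounded delays if there is $s\in\mathbb{N}$ with $p-s\le s_i(p)\le p$ for all $i\in\{1,\dots,\alpha\}$ and all $p\in\mathbb{N}$.
   Formalization: The formal theorem also assumes that each index i belongs to J(p) for infinitely many p; without it the claim fails (α=2, f=|x|²/2, J(p)={1} for all p, x_2^0=1: the second block never moves, while x*=0). *)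

(* Defs.v *)
From HB Require Import structures.
From mathcomp Require Import all_boot all_order all_algebra.
From mathcomp Require Import all_classical all_reals all_analysis.
From mathcomp Require Export all_boot all_order all_algebra.
From mathcomp Require Export all_classical all_reals all_analysis.
Export Order.TTheory GRing.Theory Num.Theory numFieldNormedType.Exports.

Set Implicit Arguments.
Unset Strict Implicit.
Unset Printing Implicit Defensive.

Local Open Scope classical_set_scope.
Local Open Scope ring_scope.

Section ProductSpace.
Context {R : realType} {alpha : nat} {n_ : 'I_alpha -> nat}.

(* The type of x is R^n with n = n_1 + ... + n_alpha; its block x_i in R^{n_i}
   is submxrow x i, and \mxrow_i reassembles the blocks. *)
Notation E := 'rV[R]_(\sum_i n_ i).

Variable ip : forall i, {dot 'rV[R]_(n_ i) for idfun}.

Definition prod_dot (x y : E) : R :=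
  \sum_i ip i (submxrow x i) (submxrow y i).

Definition prod_norm (x : E) : R := Num.sqrt (prod_dot x x).

Definition proper (f : E -> \bar R) : Prop := ~ (forall x, f x = +oo%E).

Definition strongly_convex (a : R) (f : E -> \bar R) : Prop :=
  forall (x x' : E) (t : R), 0 < t < 1 ->
    (f (t *: x + (1 - t) *: x')%R
       <= t%:E * f x + (1 - t)%:E * f x'
          - (2^-1 * a * t * (1 - t) * prod_norm (x - x') ^+ 2)%:E)%E.

Definition subdifferential (f : E -> \bar R) (x : E) : set E :=
  [set y | forall x', (f x + (prod_dot y (x' - x))%:E <= f x')%E].

(* The multivalued inverse (I + c * subdifferential f)^-1: x' is in the image
   of x when x is in x' + c * subdifferential f x'. *)
Definition resolvent (c : R) (f : E -> \bar R) (x : E) : set E :=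
  [set x' | [set x' + c *: y | y in subdifferential f x'] x].

Definition is_minimizer (f : E -> \bar R) (x : E) : Prop :=
  forall x', (f x <= f x')%E.

(* The vector (x_1^{q_1}, ..., x_alpha^{q_alpha}). *)
Definition delayed (x : nat -> E) (q : 'I_alpha -> nat) : E :=
  \mxrow_i submxrow (x (q i)) i.

Definition asynchronous_algorithm (F : E -> E) (x0 : E)
    (J : nat -> {set 'I_alpha}) (s_ : 'I_alpha -> nat -> nat) (x : nat -> E) :
    Prop :=
  x 0%N = x0 /\
  forall p i, submxrow (x p.+1) i =
    if i \in J p then submxrow (F (delayed x (fun j => s_ j p))) i
    else submxrow (x p) i.

(* Each component is updated infinitely often. Without this standard condition
   on J a block may stay frozen at x0, and no convergence can be expected. *)
Definition updates_all (J : nat -> {set 'I_alpha}) : Prop :=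
  forall i p, exists2 q, (p <= q)%N & i \in J q.

(* The lower bound p - s <= s_i(p), an inequality between integers, is the same
   with truncated subtraction. *)
Definition bounded_delays (s_ : 'I_alpha -> nat -> nat) : Prop :=
  exists s, forall i p, (p - s <= s_ i p <= p)%N.

End ProductSpace.

(* Main.v *)
From HB Require Import structures.
From mathcomp Require Import finmap ring lra.
Require Import Defs.

Set Implicit Arguments.
Unset Strict Implicit.
Unset Printing Implicit Defensive.

Local Open Scope classical_set_scope.
Local Open Scope ring_scope.

(** A lower semicontinuous function attains its infimum on a ball, and strong
    convexity makes [f] exceed its value at the centre outside a large enough
    ball; so a minimizer exists
    ([strongly_convex_minimizer_exists]).  Strong convexity also improves the
    subgradient inequality by a quadratic term, hence the subdifferential is
    strongly monotone with constant [a].  This gives the uniqueness of the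
    minimizer, whose subdifferential contains [0], and the fact that the
    resolvent is at most single-valued.  It is defined everywhere because a
    minimizer [p] of [f z + |z - x|^2 / (2 c)], again a strongly convex lower
    semicontinuous function of [z], satisfies [(x - p) / c] in the
    subdifferential of [f] at [p] ([resolvent_exists]).

    For the convergence let [xs] be the minimizer, [v = F z - xs],
    [u = z - xs] and [K = 1 + c a].  Strong monotonicity yields
    [K <v, v> <= <u, v>].  The usual consequence [|v| <= |u| / K] compares
    badly with the maximum of the block norms: it only gives the factor
    [sqrt alpha / K], which equals [1] when [c = (sqrt alpha - 1) / a].  The
    inequality itself contains more.  If [M] bounds the block norms of [u] and
    [b j] are the block norms of [v], Cauchy-Schwarz in each block gives
    [K sum_j b_j^2 <= M sum_j b_j], that is,
    [sum_j (b_j - M / (2 K))^2 <= alpha (M / (2 K))^2], so that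
    [b_i <= (1 + sqrt alpha) / (2 K) M] for every [i]
    ([quadratic_mean_bound], [block_norm_contraction]).  This factor is
    smaller than [1] because [c a > 0] and [c a >= sqrt alpha - 1] add up to
    [2 K > 1 + sqrt alpha].  A map that contracts the maximum of the block
    norms tolerates stale and partial information: once all blocks are within
    [theta^k M0] of the limit, then after the delay has passed and every block
    has been updated again they are, and stay, within [theta^(k+1) M0]
    ([asynchronous_contraction]). *)

(** * Inner products on row vectors *)

Section InnerProduct.
Context {R : realType} {n : nat} (d : {dot 'rV[R]_n for idfun}).

Lemma dotC x y : d x y = d y x.
Proof. by rewrite (hermC d) expr0 mul1r. Qed.

Lemma dot_ge0 x : 0 <= d x x.
Proof.
have [->|x0] := eqVneq x 0; first by rewrite linear0l.
exact/ltW/neq0_dnorm_gt0.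
Qed.

Lemma dot0l x : d 0 x = 0.
Proof. exact: linear0l. Qed.

Lemma dotDl x y z : d (x + y) z = d x z + d y z.
Proof. exact: linearDl. Qed.

Lemma dotBl x y z : d (x - y) z = d x z - d y z.
Proof. exact: linearBl. Qed.

Lemma dotNr x y : d x (- y) = - d x y.
Proof. exact: linearNr. Qed.

Lemma dotN2 x : d (- x) (- x) = d x x.
Proof. exact: hnormN. Qed.

Lemma dotB2 x y : d (x - y) (x - y) = d x x - 2 * d x y + d y y.
Proof. by rewrite linearBl !linearBr /= (dotC y x); ring. Qed.

Lemma dotD2 x y : d (x + y) (x + y) = d x x + 2 * d x y + d y y.
Proof. by rewrite linearDl !linearDr /= (dotC y x); ring. Qed.

Lemma dotZl t x y : d (t *: x) y = t * d x y.
Proof. exact: linearZl_LR. Qed.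

Lemma dotZr t x y : d x (t *: y) = t * d x y.
Proof. exact: linearZr_LR. Qed.

Lemma dotZ2 (t : R) x : d (t *: x) (t *: x) = t ^+ 2 * d x x.
Proof. by rewrite dotZl dotZr mulrA. Qed.

(** Positivity of the form at [<y, y> x - <x, y> y]. *)
Lemma dot_cauchy_schwarz x y : d x y <= Num.sqrt (d x x) * Num.sqrt (d y y).
Proof.
have [->|y0] := eqVneq y 0.
  by rewrite linear0r mulr_ge0.
have yy : 0 < d y y by exact: neq0_dnorm_gt0.
have := dot_ge0 (d y y *: x - d x y *: y).
rewrite dotB2 !dotZ2 dotZl dotZr.
set A := d x x; set B := d x y; set C := d y y => h.
have {h} : 0 <= C * (A * C - B ^+ 2) by lra.
rewrite pmulr_rge0// subr_ge0 => h.
rewrite -sqrtrM ?dot_ge0//.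
by apply: (le_trans (ler_norm _)); rewrite -sqrtr_sqr ler_sqrt// mulr_ge0 ?dot_ge0.
Qed.

Lemma dot_functional_bounded v :
  exists2 C : R, 0 <= C & forall w, `|d v w| <= C * `|w|.
Proof.
exists (\sum_j `|d v 'e_j|) => [|w]; first exact: sumr_ge0.
rewrite {1}(row_sum_delta w) linear_sumr (le_trans (ler_norm_sum _ _ _))//.
rewrite mulr_suml ler_sum// => j _; rewrite /= dotZr normrM mulrC.
rewrite ler_wpM2l// /Num.norm /= mx_normrE.
by apply/bigmax_geP; right; exists (ord0, j).
Qed.

(** One half of the equivalence of the norms.  The Gram matrix of the canonical
    basis is invertible by positive definiteness, so each coordinate is the
    inner product with a fixed vector and Cauchy-Schwarz applies. *)
Lemma norm_le_dot :
  exists2 C : R, 0 <= C & forall x : 'rV[R]_n, `|x| <= C * Num.sqrt (d x x).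
Proof.
pose G : 'M[R]_n := \matrix_(i, j) d 'e_i 'e_j.
have dG (u w : 'rV[R]_n) : d u w = \sum_j w 0 j * (u *m G) 0 j.
  rewrite {1}(row_sum_delta w) linear_sumr; apply: eq_bigr => j _.
  rewrite /= dotZr {1}(row_sum_delta u) linear_sumlz mxE; congr (_ * _).
  by apply: eq_bigr => i _; rewrite /= dotZl mxE.
have Gu : G \in unitmx.
  rewrite -row_free_unit -kermx_eq0; apply/rowV0P => v /sub_kermxP vG.
  apply/eqP/negP => /negP /(neq0_dnorm_gt0 (s := d)).
  by rewrite dG vG big1 ?ltxx// => j _; rewrite mxE mulr0.
(* The vectors [g j] form the basis dual to the canonical one. *)
pose g j := row j (invmx G).
have gP j x : d (g j) x = x 0 j.
  rewrite dG -row_mul mulVmx// (bigD1 j)//= big1 ?addr0.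
    by rewrite !mxE eqxx mulr1.
  by move=> k /negbTE kj; rewrite !mxE eq_sym kj mulr0.
exists (\sum_j Num.sqrt (d (g j) (g j))) => [|x]; first exact: sumr_ge0.
rewrite {1}/Num.norm /= mx_normrE; apply/bigmax_leP; split=> /=.
  by rewrite mulr_ge0 ?sumr_ge0.
move=> [i j] _ /=; rewrite (ord1 i) -gP.
apply: (@le_trans _ _ (Num.sqrt (d (g j) (g j)) * Num.sqrt (d x x))).
  rewrite ler_norml dot_cauchy_schwarz andbT lerNl -linearNr.
  by apply: le_trans (dot_cauchy_schwarz _ _) _; rewrite (hnormN d).
by rewrite ler_wpM2r// (bigD1 j)//= lerDl sumr_ge0.
Qed.

End InnerProduct.

(** * The inner product of the product space *)

Section ProductDot.
Context {R : realType} {alpha : nat} {n_ : 'I_alpha -> nat}.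
Context (ip : forall i, {dot 'rV[R]_(n_ i) for idfun}).
Local Notation E := 'rV[R]_(\sum_i n_ i).

Lemma submxrowZ (t : R) (x : E) i : submxrow (t *: x) i = t *: submxrow x i.
Proof. by apply/matrixP => j k; rewrite !mxE. Qed.

Lemma prod_dot_bilinear : bilinear_for
  (GRing.Scale.Law.clone _ _ *%R _) (GRing.Scale.Law.clone _ _ *%R _)
  (prod_dot ip).
Proof.
split=> [y|x] t u v /=; rewrite /prod_dot mulr_sumr -big_split;
  apply: eq_bigr => i _ /=; rewrite submxrowD submxrowZ.
- by rewrite linearPl.
- by rewrite linearPr.
Qed.

HB.instance Definition _ := bilinear_isBilinear.Build R E E R _ _
  (prod_dot ip) prod_dot_bilinear.

Lemma prod_dotC x y : prod_dot ip x y = (-1) ^+ false * idfun (prod_dot ip y x).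
Proof.
by rewrite expr0 mul1r; apply: eq_bigr => i _; exact: dotC.
Qed.

HB.instance Definition _ := isHermitianSesquilinear.Build R E false idfun
  (prod_dot ip) prod_dotC.

Lemma prod_dot_gt0 x : x != 0 -> 0 < prod_dot ip x x.
Proof.
move=> x0; rewrite lt0r sumr_ge0 ?andbT => [|i _]; last exact: dot_ge0.
apply: contra x0; rewrite psumr_eq0 => [/allP h|i _]; last exact: dot_ge0.
rewrite -(submxrowK x) -(submxrowK 0); apply/eqP/eq_mxrow => i.
rewrite submxrow0; apply/eqP/negP => /negP xi.
have := neq0_dnorm_gt0 (s := ip i) _ xi.
by rewrite (eqP (h i (mem_index_enum _))) ltxx.
Qed.

HB.instance Definition _ := isDotProduct.Build R E (prod_dot ip) prod_dot_gt0.

Local Notation "''[' u , v ]" := (prod_dot ip u v) : ring_scope.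
Local Notation "''[' u ]" := '[u, u] : ring_scope.

(** The rules above, with [prod_dot] as head symbol so that they rewrite. *)
Lemma prod_dot_sym x y : '[x, y] = '[y, x].
Proof. exact: (dotC (prod_dot ip)). Qed.

Lemma prod_dot_ge0 x : 0 <= '[x].
Proof. exact: (dot_ge0 (prod_dot ip)). Qed.

Lemma prod_dot0l x : '[0, x] = 0.
Proof. exact: (dot0l (prod_dot ip)). Qed.

Lemma prod_dotDl x y z : '[x + y, z] = '[x, z] + '[y, z].
Proof. exact: (dotDl (prod_dot ip)). Qed.

Lemma prod_dotBl x y z : '[x - y, z] = '[x, z] - '[y, z].
Proof. exact: (dotBl (prod_dot ip)). Qed.

Lemma prod_dotNr x y : '[x, - y] = - '[x, y].
Proof. exact: (dotNr (prod_dot ip)). Qed.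

Lemma prod_dotZl t x y : '[t *: x, y] = t * '[x, y].
Proof. exact: (dotZl (prod_dot ip)). Qed.

Lemma prod_dotZr t x y : '[x, t *: y] = t * '[x, y].
Proof. exact: (dotZr (prod_dot ip)). Qed.

Lemma prod_dotN2 x : '[- x] = '[x].
Proof. exact: (dotN2 (prod_dot ip)). Qed.

Lemma prod_dotZ2 (t : R) x : '[t *: x] = t ^+ 2 * '[x].
Proof. exact: (dotZ2 (prod_dot ip)). Qed.

Lemma prod_dotB2 x y : '[x - y] = '[x] - 2 * '[x, y] + '[y].
Proof. exact: (dotB2 (prod_dot ip)). Qed.

Lemma prod_dotD2 x y : '[x + y] = '[x] + 2 * '[x, y] + '[y].
Proof. exact: (dotD2 (prod_dot ip)). Qed.

Lemma prod_norm_sqr (x : E) : prod_norm ip x ^+ 2 = '[x].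
Proof. by rewrite sqr_sqrtr// prod_dot_ge0. Qed.

Lemma prod_dot_convex_comb (t : R) u v :
  '[t *: u + (1 - t) *: v] = t * '[u] + (1 - t) * '[v] - t * (1 - t) * '[u - v].
Proof.
rewrite prod_dotD2 !prod_dotZ2 prod_dotB2.
by rewrite prod_dotZl prod_dotZr /=; ring.
Qed.

(** At a point where [f] is infinite the inequality is trivial, so only real
    values matter. *)
Lemma strongly_convexP a (f : E -> \bar R) : (forall x, f x != -oo%E) ->
  strongly_convex ip a f <->
  forall x x' r r' t, f x = r%:E -> f x' = r'%:E -> 0 < t < 1 ->
    (f (t *: x + (1 - t) *: x')%R <=
      (t * r + (1 - t) * r' - 2^-1 * a * t * (1 - t) * '[x - x'])%:E)%E.
Proof.
move=> fNy; split=> [h x x' r r' t fx fx' t01|h x x' t t01].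
  by have := h x x' t t01; rewrite fx fx' prod_norm_sqr.
have [t0 t1] := andP t01; have t1' : 0 < 1 - t by rewrite subr_gt0.
rewrite prod_norm_sqr.
case fx : (f x) => [r||]; last by have := fNy x; rewrite fx.
- case fx' : (f x') => [r'||]; last by have := fNy x'; rewrite fx'.
    by have := h x x' r r' t fx fx' t01.
  by rewrite gt0_muley ?lte_fin// addey// addye// leey.
- rewrite gt0_muley ?lte_fin// addye; first by rewrite addye// leey.
  case fx' : (f x') => [r'||]//; last by have := fNy x'; rewrite fx'.
  by rewrite gt0_muley ?lte_fin.
Qed.

End ProductDot.

(** * Minimization of lower semicontinuous functions *)

Lemma seq_argmin {d : Order.disp_t} {V : orderType d} {T : eqType} (f : T -> V)
    (s : seq T) (x0 : T) : x0 \in s ->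
  exists2 y, y \in s & forall z, z \in s -> (f y <= f z)%O.
Proof.
elim: s x0 => // a s IH _ _; case: s IH => [_|b s /(_ b (mem_head _ _))[y ys ymin]].
  by exists a; rewrite ?mem_head// => z; rewrite inE => /eqP ->.
have [ay|/ltW ya] := leP (f a) (f y).
  exists a; rewrite ?mem_head// => z; rewrite inE => /orP[/eqP ->//|/ymin].
  exact: le_trans.
by exists y => [|z]; rewrite in_cons ?ys ?orbT// => /orP[/eqP ->|/ymin].
Qed.

(** If no point of [A] were minimal, the open sets [f y < f x], for [y] in [A],
    would cover [A]; among finitely many such [y], one with the least value is
    covered by none of them. *)
Lemma compact_lsc_min {R : realType} {T : ptopologicalType} (f : T -> \bar R)
    (A : set T) (x0 : T) :
  compact A -> A x0 -> (forall x, f x != -oo%E) -> lower_semicontinuous f ->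
  exists2 x, A x & forall y, A y -> (f x <= f y)%E.
Proof.
move=> cA Ax0 fNy /lower_semicontinuousP flsc.
apply: contrapT => nomin.
have [] := (_ : cover_compact A) T A (fun y => [set x | (f y < f x)%E]).
- by rewrite -compact_cover.
- move=> y Ay; case fy : (f y) => [r||]; last by have := fNy y; rewrite fy.
    exact: flsc.
  rewrite (_ : mkset _ = set0); first exact: open0.
  by apply/seteqP; split=> x //=; rewrite ltNge leey.
- move=> x Ax; apply: contrapT => h; apply: nomin; exists x => // y Ay.
  by rewrite leNgt; apply/negP => fyx; apply: h; exists y.
move=> D DA cov.
have [y0 y0D _] := cov x0 Ax0.
have [y yD ymin] : exists2 y, y \in D & forall z, z \in D -> (f y <= f z)%E.
  exact: (seq_argmin (s := enum_fset D) f y0D).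
have [z zD /=] := cov y (set_mem (DA y yD)).
by rewrite ltNge (ymin z zD).
Qed.

(** Used to let a convex combination tend to one of its end points without
    mentioning limits. *)
Lemma affine_le_limit {R : realType} (A B C : R) :
  (forall t, 0 < t < 1 -> A + t * B <= C) -> A + B <= C.
Proof.
move=> h; apply/ler_addgt0Pl => e e0.
(* With [1 - t = e / q] the term [(1 - t) B] is at most [e]. *)
pose q := e + `|B| + 1.
have q0 : 0 < q by rewrite /q; have := normr_ge0 B; lra.
have eq1 : e / q < 1.
  by rewrite ltr_pdivrMr// /q; have := normr_ge0 B; lra.
have eq0 : 0 < e / q by rewrite divr_gt0.
have {h} := h (1 - e / q); rewrite subr_gt0 eq1 /= gtrBl eq0 => /(_ isT) h.
have : (e / q) * B <= e.
  apply: (@le_trans _ _ (e / q * q)); last by rewrite divfK// gt_eqF.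
  by rewrite ler_pM2l// /q; have := ler_norm B; lra.
lra.
Qed.

(** * Strongly convex functions *)

Section StronglyConvex.
Context {R : realType} {alpha : nat} {n_ : 'I_alpha -> nat}.
Context (ip : forall i, {dot 'rV[R]_(n_ i) for idfun}).
Local Notation E := 'rV[R]_(\sum_i n_ i).
Local Notation "''[' u , v ]" := (prod_dot ip u v) : ring_scope.
Local Notation "''[' u ]" := '[u, u] : ring_scope.

Lemma proper_finite (f : E -> \bar R) : (forall x, f x != -oo%E) -> proper f ->
  exists x r, f x = r%:E.
Proof.
move=> fNy fp; apply: contrapT => h; apply: fp => x.
case fx : (f x) => [r||]//; first by case: h; exists x, r.
by have := fNy x; rewrite fx.
Qed.

(** Let [f x0] be finite and [m] be the minimum of [f] on the unit ball around
    [x0].  If [|x - x0| > 1] and [f x < f x0], strong convexity on the segment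
    from [x] to [x0], at its point on the unit sphere, bounds [|x - x0|] in
    terms of [f x0 - m].  So the minimum of [f] on a ball with that radius is
    global.  Here [|.|] is the
    maximum norm, and [C] compares it with the norm of the product. *)
Lemma strongly_convex_minimizer_exists a (f : E -> \bar R) : 0 < a ->
  (forall x, f x != -oo%E) -> lower_semicontinuous f ->
  strongly_convex ip a f -> proper f -> exists x, is_minimizer f x.
Proof.
move=> a0 fNy flsc /(strongly_convexP ip _ fNy) fcvx /(proper_finite fNy)[x0 [r0 fx0]].
have ballmin rho : 0 <= rho -> exists2 x, `|x - x0| <= rho &
    forall y, `|y - x0| <= rho -> (f x <= f y)%E.
  move=> rho0; pose B := closed_ball_ Num.norm x0 rho.
  have Bx0 : B x0 by rewrite /B/closed_ball_ /= subrr normr0.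
  have cB : compact B.
    apply: bounded_closed_compact; last exact: closed_closed_ball_.
    exists (rho + `|x0|); split; first exact: num_real.
    move=> M hM x; rewrite /B /closed_ball_ /= => hx; apply/ltW.
    apply: le_lt_trans hM; rewrite -lerBlDr distrC in hx *.
    by apply: le_trans hx; rewrite lerB_dist.
  have [x Bx xmin] := compact_lsc_min cB Bx0 fNy flsc.
  by exists x => [|y hy]; [rewrite distrC|apply: xmin; rewrite /B/closed_ball_/= distrC].
have [m0 m0B m0min] := ballmin 1 ler01.
have [m fm0] : exists m, f m0 = m%:E.
  have := m0min x0; rewrite subrr normr0 ler01 fx0 => /(_ isT).
  by case fm0 : (f m0) => [m||]; [exists m| |have := fNy m0; rewrite fm0].
have [C C0 normC] := norm_le_dot (prod_dot ip).
pose rho0 := 1 + 2 * C ^+ 2 * (r0 - m) / a.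
have mr0 : m <= r0.
  by rewrite -lee_fin -fm0 -fx0; apply: m0min; rewrite subrr normr0.
have rho01 : 1 <= rho0.
  by rewrite lerDl divr_ge0 ?mulr_ge0 ?sqr_ge0 ?subr_ge0// ltW.
have [xs xsB xsmin] := ballmin rho0 (le_trans ler01 rho01).
exists xs => x.
have [/xsmin//|xfar] := leP `|x - x0| rho0.
have xs0 : (f xs <= r0%:E)%E.
  by rewrite -fx0; apply: xsmin; rewrite subrr normr0 (le_trans ler01).
have [/(le_trans xs0)//|] := leP r0%:E (f x).
case fx : (f x) => [r||]//; last by have := fNy x; rewrite fx.
rewrite lte_fin => rr0.
have rho1 : 1 < `|x - x0| by exact: le_lt_trans xfar.
have rhogt0 : 0 < `|x - x0| by exact: lt_trans rho1.
have t01 : 0 < `|x - x0|^-1 < 1 by rewrite invr_gt0 rhogt0 invf_lt1.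
have := le_trans (m0min (`|x - x0|^-1 *: x + (1 - `|x - x0|^-1) *: x0) _)
  (fcvx _ _ _ _ _ fx fx0 t01).
have -> : `|x - x0|^-1 *: x + (1 - `|x - x0|^-1) *: x0 - x0 =
    `|x - x0|^-1 *: (x - x0).
  by apply/matrixP => i j; rewrite !mxE; ring.
rewrite normrZ ger0_norm ?invr_ge0// mulVf ?gt_eqF// lexx => /(_ isT).
rewrite fm0 lee_fin.
have : `|x - x0| ^+ 2 <= C ^+ 2 * '[x - x0].
  have <- : Num.sqrt '[x - x0] ^+ 2 = '[x - x0].
    by rewrite sqr_sqrtr// prod_dot_ge0.
  by rewrite -exprMn lerXn2r// nnegrE ?mulr_ge0.
have [t0 t1] := andP t01.
move: ('[x - x0]) (`|x - x0|) => N rho in xfar rho1 rhogt0 t0 t1 *.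
move=> hN hm.
move: xfar; rewrite ltNge => /negP; case.
rewrite /rho0 -lerBlDl ler_pdivlMr//.
(* With [t = 1 / rho] the factor [a t (1 - t)] is that of the strong convexity
   inequality, and [rho^2 <= C^2 N] where [N] is the squared product norm. *)
have -> : (rho - 1) * a = a * (rho^-1 * (1 - rho^-1)) * rho ^+ 2.
  by field; rewrite gt_eqF.
apply: (@le_trans _ _ (a * (rho^-1 * (1 - rho^-1)) * (C ^+ 2 * N))).
  by rewrite ler_wpM2l// !mulr_ge0 ?subr_ge0 ?ltW.
have trr : rho^-1 * r <= rho^-1 * r0 by rewrite ler_pM2l// ltW.
have -> : a * (rho^-1 * (1 - rho^-1)) * (C ^+ 2 * N) =
  C ^+ 2 * (a * (rho^-1 * (1 - rho^-1)) * N) by ring.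
have -> : 2 * C ^+ 2 * (r0 - m) = C ^+ 2 * (2 * (r0 - m)) by ring.
by rewrite ler_wpM2l ?sqr_ge0//; lra.
Qed.

Section Subdifferential.
Context (a : R) (f : E -> \bar R).
Context (a0 : 0 < a) (fNy : forall x, f x != -oo%E).
Context (fcvx : strongly_convex ip a f) (fp : proper f).

Lemma subdifferential_finite x y :
  subdifferential ip f x y -> exists r, f x = r%:E.
Proof.
have [x0 [r0 fx0]] := proper_finite fNy fp.
move=> /(_ x0); case fx : (f x) => [r||].
- by exists r.
- by rewrite fx0.
- by have := fNy x; rewrite fx.
Qed.

(** The subgradient inequality at [t x + (1 - t) x'], combined with strong
    convexity and divided by [1 - t], tends to the claim as [t] tends to [1]. *)
Lemma subdifferential_strong x x' r r' y : f x = r%:E -> f x' = r'%:E ->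
  subdifferential ip f x y ->
  r + '[y, x' - x] + 2^-1 * a * '[x' - x] <= r'.
Proof.
move=> fx fx' fy; apply: affine_le_limit => t t01.
have [t0 t1] := andP t01.
have := le_trans (fy _) (((strongly_convexP ip a fNy).1 fcvx) _ _ _ _ _ fx fx' t01).
have -> : t *: x + (1 - t) *: x' - x = (1 - t) *: (x' - x).
  by apply/matrixP => i j; rewrite !mxE; ring.
rewrite fx lee_fin /= prod_dotZr -(opprB x' x) prod_dotN2.
move=> h; rewrite -(ler_pM2l (_ : 0 < 1 - t)) ?subr_gt0//.
move: h; move: ('[x' - x]) ('[y, x' - x]) => N Y.
lra.
Qed.

(** Sum of the strong subgradient inequalities from [x] to [x'] and back. *)
Lemma subdifferential_strongly_monotone x x' y y' :
  subdifferential ip f x y -> subdifferential ip f x' y' ->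
  a * '[x - x'] <= '[y - y', x - x'].
Proof.
move=> fy fy'; have [r fx] := subdifferential_finite fy.
have [r' fx'] := subdifferential_finite fy'.
have := subdifferential_strong fx fx' fy.
have := subdifferential_strong fx' fx fy'.
rewrite -(opprB x x') prod_dotN2 prod_dotNr.
rewrite (prod_dotBl ip y); lra.
Qed.

Lemma minimizer_subdifferential x : is_minimizer f x -> subdifferential ip f x 0.
Proof. by move=> fx x'; rewrite /= prod_dot0l adde0. Qed.

Lemma minimizer_unique x x' : is_minimizer f x -> is_minimizer f x' -> x = x'.
Proof.
move=> /minimizer_subdifferential fx /minimizer_subdifferential fx'.
have := subdifferential_strongly_monotone fx fx'.
rewrite subrr prod_dot0l => h.
apply/eqP; rewrite -subr_eq0; apply/negP => /negP /prod_dot_gt0 - /(_ ip).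
by rewrite ltNge -(pmulr_rle0 _ a0) h.
Qed.

(** If [p + c y = p' + c y'] then [y - y'] is a negative multiple of [p - p'],
    which contradicts monotonicity unless [p = p']. *)
Lemma resolvent_unique c x p p' : 0 < c ->
  resolvent ip c f x p -> resolvent ip c f x p' -> p = p'.
Proof.
move=> c0 [y fy yE] [y' fy' y'E].
have := subdifferential_strongly_monotone fy fy'.
have -> : y - y' = - c^-1 *: (p - p').
  apply: (scalerI (lt0r_neq0 c0)); rewrite scalerA mulrN divff ?gt_eqF// scaleN1r.
  have -> : c *: (y - y') = (x - p) - (x - p').
    by rewrite scalerBr -{1}yE -y'E [p + _]addrC [p' + _]addrC !addrK.
  by apply/matrixP => i j; rewrite !mxE; ring.
rewrite prod_dotZl /= -subr_ge0 -mulrBl => h.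
apply/eqP; rewrite -subr_eq0; apply/negP => /negP /prod_dot_gt0 - /(_ ip) pp.
move: h; rewrite pmulr_lge0// leNgt => /negP; apply.
by rewrite subr_lt0 (lt_trans _ a0)// oppr_lt0 invr_gt0.
Qed.

(** Strong monotonicity between [p] and [xs], where the subgradients are
    [(z - p) / c] and [0].  The inequality is kept in this form, which is
    stronger than the Lipschitz bound that Cauchy-Schwarz deduces from it. *)
Lemma resolvent_contraction c xs z p : 0 < c -> is_minimizer f xs ->
  resolvent ip c f z p ->
  (1 + c * a) * '[p - xs] <= '[z - xs, p - xs].
Proof.
move=> c0 /minimizer_subdifferential fxs [y fy <-].
have := subdifferential_strongly_monotone fy fxs; rewrite subr0 => h.
rewrite addrAC (prod_dotDl ip _ (c *: y)) prod_dotZl.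
by rewrite mulrDl mul1r lerD2l -mulrA ler_pM2l.
Qed.

End Subdifferential.

(** The quadratic term is bounded below near [z] by its affine minorant, and
    linear functionals are bounded. *)
Lemma lower_semicontinuous_add_quadratic (k : R) (w : E) (f : E -> \bar R) :
  0 <= k -> (forall x, f x != -oo%E) -> lower_semicontinuous f ->
  lower_semicontinuous (fun x => f x + (k * '[x - w])%:E)%E.
Proof.
move=> k0 fNy flsc z b; rewrite -lteBlDr// -EFinB => hz.
(* A real number [b'] separates [b] minus the quadratic term from [f z]; the
   slack [e] below is left for the variation of the quadratic term. *)
have [b' bb' b'f] : exists2 b', b - k * '[z - w] < b' & (b'%:E < f z)%E.
  move: hz; case fz : (f z) => [r||] //.
    rewrite lte_fin => h; exists (((b - k * '[z - w]) + r) / 2); rewrite ?lte_fin; lra.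
  by move=> _; exists (b - k * '[z - w] + 1); rewrite ?ltry// ltrDl.
have [V nV Vf] := flsc z b' b'f.
have [C C0 Cv] := dot_functional_bounded (prod_dot ip) (z - w).
pose e := b' - (b - k * '[z - w]).
have e0 : 0 < e by rewrite subr_gt0.
pose D := k * (2 * C) + 1.
have D0 : 0 < D by rewrite ltr_wpDl ?mulr_ge0.
exists (V `&` ball z (e / D)).
  by apply: filterI => //; apply: nbhsx_ballx; rewrite divr_gt0.
move=> x [/Vf b'fx]; rewrite -ball_normE /= => zx.
rewrite -lteBlDr// -EFinB; apply: le_lt_trans b'fx; rewrite lee_fin lerBlDr.
have -> : x - w = (z - w) - (z - x) by apply/matrixP => i j; rewrite !mxE; ring.
rewrite prod_dotB2.
have h1 : k * (2 * '[z - w, z - x]) <= e.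
  apply: (@le_trans _ _ (k * (2 * C) * `|z - x|)).
    rewrite -!mulrA !ler_wpM2l//; exact: le_trans (ler_norm _) (Cv _).
  apply: (@le_trans _ _ (D * (e / D))); last by rewrite mulrC divfK ?gt_eqF.
  by apply: ler_pM => //; [rewrite !mulr_ge0|rewrite lerDl|exact: ltW].
have h2 : 0 <= k * '[z - x] by rewrite mulr_ge0// prod_dot_ge0.
by move: h1 h2; rewrite /e; lra.
Qed.

Lemma strongly_convex_add_quadratic (a k : R) (w : E) (f : E -> \bar R) :
  0 <= k -> (forall x, f x != -oo%E) -> strongly_convex ip a f ->
  strongly_convex ip a (fun x => f x + (k * '[x - w])%:E)%E.
Proof.
move=> k0 fNy /(strongly_convexP ip _ fNy) fcvx.
have fin x r : (f x + (k * '[x - w])%:E)%E = r%:E -> f x = (r - k * '[x - w])%:E.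
  by case: (f x) => //= s [<-]; rewrite addrK.
apply/strongly_convexP => [x|x x' r r' t /fin fx /fin fx' t01].
  by move: (fNy x); case: (f x).
apply: le_trans (leeD2r _ (fcvx _ _ _ _ _ fx fx' t01)) _.
rewrite -EFinD lee_fin.
have -> : t *: x + (1 - t) *: x' - w = t *: (x - w) + (1 - t) *: (x' - w).
  by apply/matrixP => i j; rewrite !mxE; ring.
rewrite prod_dot_convex_comb.
have -> : x - w - (x' - w) = x - x' by apply/matrixP => i j; rewrite !mxE; ring.
have [t0 t1] := andP t01.
have : 0 <= k * (t * (1 - t) * '[x - x']).
  by rewrite !mulr_ge0 ?prod_dot_ge0 ?subr_ge0// ltW.
by lra.
Qed.

(** Proximal characterization: the minimizer [p] of [g] is compared with the
    points [t p + (1 - t) z] of the segment from [p] to [z], and [t] tends to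
    [1]. *)
Lemma resolvent_exists a (f : E -> \bar R) c x : 0 < a ->
  (forall x, f x != -oo%E) -> lower_semicontinuous f ->
  strongly_convex ip a f -> proper f -> 0 < c ->
  exists p, resolvent ip c f x p.
Proof.
move=> a0 fNy flsc fcvx fp c0.
pose k := (2 * c)^-1; have k0 : 0 < k by rewrite invr_gt0 mulr_gt0.
pose g z := (f z + (k * '[z - x])%:E)%E.
have [x0 [r0 fx0]] := proper_finite fNy fp.
have [] := @strongly_convex_minimizer_exists a g a0.
- by move=> z; rewrite /g; move: (fNy z); case: (f z).
- by apply: lower_semicontinuous_add_quadratic => //; exact: ltW.
- by apply: strongly_convex_add_quadratic => //; exact: ltW.
- by move=> /(_ x0); rewrite /g fx0.
move=> p pmin.
have [r fx] : exists r, f p = r%:E.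
  have := pmin x0; rewrite /g fx0; case fx : (f p) => [r||] //; first by exists r.
  by have := fNy p; rewrite fx.
exists p; exists (c^-1 *: (x - p)); last first.
  by rewrite scalerA divff ?gt_eqF// scale1r addrC subrK.
move=> z; rewrite fx -EFinD.
case fz : (f z) => [s||]; last by have := fNy z; rewrite fz.
2: by rewrite leey.
rewrite lee_fin prod_dotZl /=.
(* Splits off the part affine in [t]: the quadratic term contributes
   [(1 - t) k '[z - p]] after division by [1 - t]. *)
rewrite -[leLHS](subrK (k * '[z - p])).
apply: affine_le_limit => t t01; have [t0 t1] := andP t01.
have := le_trans (pmin (t *: p + (1 - t) *: z))
  (leeD2r _ ((strongly_convexP ip a fNy).1 fcvx _ _ _ _ _ fx fz t01)).
have -> : t *: p + (1 - t) *: z - x = (1 - t) *: (z - p) - (x - p).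
  by apply/matrixP => i j; rewrite !mxE; ring.
have -> : '[(1 - t) *: (z - p) - (x - p)] =
    (1 - t) ^+ 2 * '[z - p] - 2 * ((1 - t) * '[x - p, z - p]) + '[p - x].
  rewrite (prod_dotB2 ip (_ *: _)) prod_dotZ2 prod_dotZl (prod_dot_sym ip (z - p)).
  by rewrite -(opprB p x) prod_dotN2.
rewrite /g fx -!EFinD lee_fin -(opprB z p) prod_dotN2.
have -> : c^-1 = 2 * k by rewrite /k; field; rewrite gt_eqF.
have := prod_dot_ge0 ip (z - p).
move: ('[z - p]) ('[x - p, z - p]) ('[p - x]) => N Y M N0 h.
have h' : 0 <= a * t * (1 - t) * N.
  by rewrite !mulr_ge0 ?subr_ge0// ltW.
rewrite -(ler_pM2l (_ : 0 < 1 - t)) ?subr_gt0//; lra.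
Qed.

End StronglyConvex.

(** * Contraction in the maximum of the block norms *)

(** Completing the square: [b] lies in the ball of radius [sqrt alpha * m] around
    the constant vector [m], where [m = M / (2 K)]. *)
Lemma quadratic_mean_bound {R : rcfType} {alpha : nat} (b : 'I_alpha -> R)
    (K M : R) : 0 < K -> 0 <= M ->
  K * (\sum_j b j ^+ 2) <= M * \sum_j b j ->
  forall i, b i <= (1 + Num.sqrt alpha%:R) / (2 * K) * M.
Proof.
move=> K0 M0 h i; pose m := M / (2 * K).
have m0 : 0 <= m by rewrite divr_ge0// mulr_ge0// ltW.
have hm : \sum_j (b j - m) ^+ 2 <= alpha%:R * m ^+ 2.
  have -> : \sum_j (b j - m) ^+ 2 =
      \sum_j b j ^+ 2 - 2 * m * (\sum_j b j) + alpha%:R * m ^+ 2.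
    rewrite (eq_bigr (fun j => b j ^+ 2 - 2 * m * b j + m ^+ 2)); last first.
      by move=> j _; ring.
    by rewrite big_split sumrB -mulr_sumr sumr_const card_ord -[m ^+ 2 *+ _]mulr_natl.
  rewrite gerDr subr_le0 -(ler_pM2l K0); apply: le_trans h _.
  by rewrite le_eqVlt; apply/orP; left; apply/eqP; rewrite /m; field; rewrite gt_eqF.
have : (b i - m) ^+ 2 <= (Num.sqrt alpha%:R * m) ^+ 2.
  rewrite exprMn sqr_sqrtr//; apply: le_trans hm.
  by rewrite (bigD1 i)//= lerDl sumr_ge0// => j _; rewrite sqr_ge0.
rewrite -ler_sqrt ?sqr_ge0// !sqrtr_sqr (ger0_norm (mulr_ge0 _ _))//.
move=> /(le_trans (ler_norm _)).
rewrite lerBlDr => /le_trans; apply; rewrite le_eqVlt; apply/orP; left; apply/eqP.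
by rewrite /m; field; rewrite gt_eqF.
Qed.

(** The quantity [b i p] stands for the error of block [i] at time [p].  By
    induction on [k], all errors are eventually at most [theta^k M0], where [M0]
    bounds the initial errors. *)
Lemma asynchronous_contraction {R : realType} {alpha : nat}
    (b : 'I_alpha -> nat -> R) (J : nat -> {set 'I_alpha})
    (s_ : 'I_alpha -> nat -> nat) (theta : R) :
  0 <= theta < 1 -> (forall i, 0 <= b i 0%N) ->
  updates_all J -> bounded_delays s_ ->
  (forall p i, i \notin J p -> b i p.+1 = b i p) ->
  (forall p i M, i \in J p -> (forall j, b j (s_ j p) <= M) ->
    b i p.+1 <= theta * M) ->
  forall e, 0 < e -> exists P, forall p i, (P <= p)%N -> b i p <= e.
Proof.
move=> /andP[th0 th1] b0 upd [s delay] frozen contr.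
pose M0 := \sum_i b i 0%N.
have M00 : 0 <= M0 by rewrite sumr_ge0.
have bnd p : forall q i, (q <= p)%N -> b i q <= M0.
  elim: p => [|p IH] q i.
    by rewrite leqn0 => /eqP ->; rewrite /M0 (bigD1 i)//= lerDl sumr_ge0.
  rewrite leq_eqVlt => /orP[/eqP ->|]; last exact: IH.
  have [iJ|iJ] := boolP (i \in J p); last by rewrite frozen// IH.
  have h j : b j (s_ j p) <= M0 by apply: IH; case/andP: (delay j p).
  apply: le_trans (contr p i M0 iJ h) _.
  by rewrite -[leRHS]mul1r ler_wpM2r// ltW.
have step k : exists P, forall p i, (P <= p)%N -> b i p <= theta ^+ k * M0.
  elim: k => [|k [P hP]].
    by exists 0%N => p i _; rewrite expr0 mul1r; exact: (bnd p).
  (* Time [q i] is an update of block [i] late enough to read only data from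
     time [P] on. *)
  have /boolp.choice[q hq] : forall i, exists q, (P + s <= q)%N /\ i \in J q.
    by move=> i; have [q ? ?] := upd i (P + s)%N; exists q.
  have upP p i : (P + s <= p)%N -> i \in J p -> b i p.+1 <= theta ^+ k.+1 * M0.
    move=> Pp iJ; rewrite exprS -mulrA; apply: (contr p i _ iJ) => j.
    apply: hP; case/andP: (delay j p) => h _; apply: leq_trans h.
    by rewrite leq_subRL ?(leq_trans (leq_addl _ _) Pp)// addnC.
  exists (\max_i q i).+1 => p i qp.
  have {qp} : (q i < p)%N.
    by apply: leq_trans qp; rewrite ltnS; exact: leq_bigmax.
  have [qP iJq] := hq i.
  elim: p => // p IH; rewrite ltnS leq_eqVlt => /orP[/eqP <-|qp].
    exact: upP.
  have [iJ|iJ] := boolP (i \in J p); last by rewrite frozen// IH.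
  by apply: upP => //; apply: leq_trans qP (ltnW qp).
move=> e e0.
have : (fun k => theta ^+ k * M0) @ \oo --> 0 * M0.
  by apply: cvgMl; apply: cvg_expr; rewrite ger0_norm.
rewrite mul0r => /cvgrPdist_le /(_ _ e0) [k _ /(_ k (leqnn k)) /=].
rewrite sub0r normrN ger0_norm ?mulr_ge0 ?exprn_ge0// => hk.
have [P hP] := step k; exists P => p i Pp.
apply: le_trans (hP p i Pp) _.
exact: hk.
Qed.

(** * Convergence of the asynchronous algorithm *)

Section Convergence.
Context {R : realType} {alpha : nat} {n_ : 'I_alpha -> nat}.
Context (ip : forall i, {dot 'rV[R]_(n_ i) for idfun}).
Local Notation E := 'rV[R]_(\sum_i n_ i).
Local Notation "''[' u , v ]" := (prod_dot ip u v) : ring_scope.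
Local Notation "''[' u ]" := '[u, u] : ring_scope.

Definition block_norm i (x : E) : R :=
  Num.sqrt (ip i (submxrow x i) (submxrow x i)).

Lemma prod_dot_block_norm x : '[x] = \sum_i block_norm i x ^+ 2.
Proof. by apply: eq_bigr => i _; rewrite sqr_sqrtr// dot_ge0. Qed.

Lemma block_norm_contraction K (u v : E) M : 0 < K -> K * '[v] <= '[u, v] ->
  (forall j, block_norm j u <= M) ->
  forall i, block_norm i v <= (1 + Num.sqrt alpha%:R) / (2 * K) * M.
Proof.
move=> K0 h uM i.
apply: (quadratic_mean_bound (b := fun j => block_norm j v)) => //.
  by apply: le_trans (uM i); rewrite sqrtr_ge0.
rewrite -prod_dot_block_norm; apply: le_trans h _.
rewrite mulr_sumr ler_sum// => j _.
apply: le_trans (dot_cauchy_schwarz _ _ _) _.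
by apply: ler_wpM2r; [exact: sqrtr_ge0|exact: uM].
Qed.

Lemma cvg_block_norm (x : nat -> E) (y : E) :
  (forall e, 0 < e -> exists P, forall p i, (P <= p)%N ->
    block_norm i (x p - y) <= e) ->
  x @ \oo --> y.
Proof.
move=> h; have [C C0 normC] := norm_le_dot (prod_dot ip).
apply/cvgrPdist_le => e e0.
pose D := C * Num.sqrt alpha%:R + 1.
have D0 : 0 < D by rewrite ltr_wpDl ?mulr_ge0 ?sqrtr_ge0.
have [P hP] := h (e / D) (divr_gt0 e0 D0).
exists P => // p /= Pp; rewrite distrC; apply: le_trans (normC _) _ => /=.
apply: (@le_trans _ _ (C * (Num.sqrt alpha%:R * (e / D)))).
  rewrite ler_wpM2l//.
  have ed : 0 <= e / D by rewrite ltW// divr_gt0.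
  rewrite -(ger0_norm ed) -sqrtr_sqr -sqrtrM// ler_sqrt.
    rewrite prod_dot_block_norm -[alpha in alpha%:R]card_ord mulr_natl.
    rewrite -sumr_const ler_sum// => i _.
    by rewrite lerXn2r ?nnegrE ?sqrtr_ge0// hP.
  by rewrite mulr_ge0 ?sqr_ge0.
rewrite mulrA -{2}(divfK (lt0r_neq0 D0) e) [leRHS]mulrC.
by rewrite ler_wpM2r ?ltW ?divr_gt0// /D ltrDl.
Qed.

Lemma asynchronous_resolvent_cvg a f c F (xs : E) x0 J s_ x :
  0 < a -> (forall z, f z != -oo%E) ->
  strongly_convex ip a f -> proper f -> is_minimizer f xs ->
  0 < c -> (Num.sqrt alpha%:R - 1) / a <= c ->
  (forall z, resolvent ip c f z = [set F z]) ->
  updates_all J -> bounded_delays s_ ->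
  asynchronous_algorithm F x0 J s_ x -> x @ \oo --> xs.
Proof.
move=> a0 fNy fcvx fp xsmin c0 hc FE upd delay [_ rec].
have ca0 : 0 < c * a by rewrite mulr_gt0.
have K0 : 0 < 1 + c * a by rewrite addr_gt0.
apply: cvg_block_norm.
apply: (@asynchronous_contraction _ _ (fun i p => block_norm i (x p - xs)) J s_
  ((1 + Num.sqrt alpha%:R) / (2 * (1 + c * a)))) => //.
- rewrite divr_ge0 ?mulr_ge0 ?addr_ge0 ?sqrtr_ge0//; last exact: ltW.
  rewrite ltr_pdivrMr ?mulr_gt0// mul1r.
  by move: hc; rewrite ler_pdivrMr//; lra.
- by move=> i; exact: sqrtr_ge0.
- move=> p i iJ; rewrite /block_norm !submxrowB rec.
  by rewrite (negbTE iJ).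
- move=> p i M iJ hM.
  pose z := delayed x (fun j => s_ j p).
  have -> : block_norm i (x p.+1 - xs) = block_norm i (F z - xs).
    by rewrite /block_norm !submxrowB rec iJ.
  apply: (block_norm_contraction (u := z - xs)) => //.
    apply: (resolvent_contraction fNy fcvx fp c0 xsmin).
    by rewrite FE.
  move=> j; have := hM j; rewrite /block_norm !submxrowB.
  by rewrite /z /delayed mxrowK.
Qed.

End Convergence.

Theorem corollary4p6 (R : realType) (alpha : nat) (n_ : 'I_alpha -> nat)
    (ip : forall i : 'I_alpha, {dot 'rV[R]_(n_ i) for idfun})
    (a : R) (f : 'rV[R]_(\sum_i n_ i) -> \bar R) :
  (1 <= alpha)%N ->
  0 < a ->
  (forall x, f x != -oo%E) ->
  lower_semicontinuous f ->
  strongly_convex ip a f ->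
  proper f ->
  exists2 xstar : 'rV[R]_(\sum_i n_ i),
    unique (is_minimizer f) xstar &
    forall c : R, 0 < c -> (Num.sqrt alpha%:R - 1) / a <= c ->
      exists2 F : 'rV[R]_(\sum_i n_ i) -> 'rV[R]_(\sum_i n_ i),
        (forall x, resolvent ip c f x = [set F x]) &
        forall (x0 : 'rV[R]_(\sum_i n_ i)) (J : nat -> {set 'I_alpha})
            (s_ : 'I_alpha -> nat -> nat) (x : nat -> 'rV[R]_(\sum_i n_ i)),
          (forall p, J p != finset.set0) ->
          updates_all J ->
          bounded_delays s_ ->
          asynchronous_algorithm F x0 J s_ x ->
          x @ \oo --> xstar.
Proof.
move=> _ a0 fNy flsc fcvx fp.
have [xs xsmin] := strongly_convex_minimizer_exists a0 fNy flsc fcvx fp.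
exists xs; first by split=> // y ymin; exact: (minimizer_unique a0 fNy fcvx fp).
move=> c c0 hc.
have /boolp.choice[F hF] x := resolvent_exists x a0 fNy flsc fcvx fp c0.
have FE x : resolvent ip c f x = [set F x].
  apply/seteqP; split=> y; last by move=> ->.
  by move=> hy; exact: (resolvent_unique a0 fNy fcvx fp c0 hy (hF x)).
exists F => // x0 J s_ x _ upd delay alg.
exact: (asynchronous_resolvent_cvg a0 fNy fcvx fp xsmin c0 hc FE upd delay alg).
Qed.
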